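(* Let $G$ be a finite graph and let $a,b,s$ be vertices of $G$. In the random orientation model $O$, the events $\{a\in \overrightarrow{C}_s(G)\}$ and $\{b\in \overrightarrow{C}_s(G)\}$ are positively correlated, that is, \[P_O\big(a\in \overrightarrow{C}_s(G)\big)\,P_O\big(b\in \overrightarrow{C}_s(G)\big)\le P_O\big(a\in\overrightarrow{C}_s(G),\ b\in \overrightarrow{C}_s(G)\big).\]
   Context: $G$ is a fixed undirected graph. Model $O$ (random orientation): every edge of $G$ is directed in one of its two possible directions, each with probability $1/2$, independently of all other edges. $P_O$ denotes probability in this model. For a vertex $v$, the out-cluster $\overrightarrow{C}_v(G)\subseteq V(G)$ is the random set of all vertices $u$ for which there is a directed path from $v$ to $u$ (by convention $v\in\overrightarrow{C}_v(G)$). Thus $\{a\in\overrightarrow{C}_s(G)\}$ is the event that there is a directed path from $s$ to $a$. *)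

(* Defs.v *)
From mathcomp Require Import all_boot all_order all_algebra.

Set Implicit Arguments.
Unset Strict Implicit.
Unset Printing Implicit Defensive.

Import GRing.Theory Num.Theory.
Local Open Scope ring_scope.

(* Finite undirected graphs; parallel edges and loops are allowed, a simple
   graph being the case of pairwise distinct two-element edges. The order in
   which [ends e] lists the two endpoints of [e] carries no meaning: it only
   gives names to the two directions of [e]. *)
Record graph := Graph {
  vertex : finType;
  edge : finType;
  ends : edge -> vertex * vertex
}.

(* [o e = true] directs [e] from [(ends e).1] to [(ends e).2], and
   [o e = false] directs it the other way. *)
Definition orientation (G : graph) := {ffun edge G -> bool}.

Definition edge_tail (G : graph) (o : orientation G) (e : edge G) : vertex G :=
  if o e then (ends e).1 else (ends e).2.

Definition edge_head (G : graph) (o : orientation G) (e : edge G) : vertex G :=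
  if o e then (ends e).2 else (ends e).1.

Definition directed_adj (G : graph) (o : orientation G) : rel (vertex G) :=
  [rel x y | [exists e, (edge_tail o e == x) && (edge_head o e == y)]].

Definition out_cluster (G : graph) (o : orientation G) (v : vertex G) :
    {set vertex G} :=
  [set u | connect (directed_adj o) v u].

(* The product of the fair-coin measures on the directions of the edges. *)
Definition PO (R : realFieldType) (G : graph) (A : {set orientation G}) : R :=
  \sum_(o in A) \prod_(e : edge G) 2^-1.

(* Main.v *)
Require Import Defs.
From mathcomp Require Import all_boot all_order all_algebra.
From mathcomp Require Import lra.

(** The out-cluster of [s] in a uniform random orientation has the same law as
    the cluster of [s] in bond percolation at density 1/2 on the same graph.
    Indeed, explore the out-cluster outwards from [s]: an edge matters only
    from whichever endpoint is reached first, and seen from there it is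
    usable with probability 1/2, independently of the rest.  Membership of
    [a] in the percolation cluster is an increasing function of the set of open
    edges, so Harris' inequality gives the positive correlation.

    Since both measures are uniform, the equality of laws is proved by a
    bijection [open_of] from orientations to edge sets that preserves the
    cluster.  It declares an edge open when it is directed away from the
    endpoint that is closer to [s] (distances being those of the oriented
    graph; ties are resolved by the names of the two directions).  By
    induction on [k], the vertices within distance [k] of [s] are the same in
    the oriented graph and in the percolation graph
    ([layer_open_of]).  Hence the clusters agree, and the distances that decide
    how to read each edge can be recovered from the set of open edges,
    which makes the map injective. *)

Set Implicit Arguments.
Unset Strict Implicit.
Unset Printing Implicit Defensive.

Import Order.TTheory GRing.Theory Num.Theory.
Local Open Scope ring_scope.

(** * Harris' inequality for uniform random subsets *)

Lemma sum_subsetU1 (V : nmodType) (E : finType) (e : E) (S : {set E})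
    (f : {set E} -> V) : e \notin S ->
  \sum_(w : {set E} | w \subset e |: S) f w
  = \sum_(w : {set E} | w \subset S) (f w + f (e |: w)).
Proof.
move=> eS; rewrite big_split /= (bigID (fun w : {set E} => e \in w)) /= addrC.
congr (_ + _).
  apply: eq_bigl => w; rewrite -(@setU1K _ e S) // subsetD1.
  by rewrite setU1K.
rewrite (reindex_onto (fun w => e |: w) (fun w => w :\ e)) /=; last first.
  by move=> w /andP[_ ew]; rewrite setD1K.
apply: eq_bigl => w; rewrite setU11 andbT subUset sub1set setU11 /=.
apply/andP/idP => [[sw /eqP <-]|wS].
  by rewrite -(setU1K eS) setSD // subUset sub1set setU11.
split; first by rewrite (subset_trans wS) ?subsetUr.
by rewrite setU1K //; apply: contra eS; apply: (subsetP wS).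
Qed.

(** Induction on [S]: summing out one element [e] leaves an increasing function
    of the remaining elements, and for a fixed choice of these, [f] and [g]
    both increase when [e] is added, so Chebyshev's inequality for two values
    bounds the product of the sums by twice the sum of the products. *)
Lemma harris_subset (R : realDomainType) (E : finType) (S : {set E})
    (f g : {set E} -> R) :
    {homo f : v w / v \subset w >-> v <= w} ->
    {homo g : v w / v \subset w >-> v <= w} ->
  (\sum_(w : {set E} | w \subset S) f w) * (\sum_(w : {set E} | w \subset S) g w)
  <= 2 ^+ #|S| * \sum_(w : {set E} | w \subset S) f w * g w.
Proof.
have [n leSn] := ubnP #|S|; elim: n S leSn f g => // n IHn S leSn f g f_mono g_mono.
have [->|[e eS]] := set_0Vmem S.
  have sub0 (h : {set E} -> R) : \sum_(w : {set E} | w \subset set0) h w = h set0.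
    by rewrite (big_pred1 set0) // => w; rewrite subset0.
  by rewrite !sub0 cards0 expr0 mul1r.
rewrite -(setD1K eS); set S' := S :\ e.
have eS' : e \notin S' by rewrite setD11.
have leS'n : (#|S'| < n)%N by move: leSn; rewrite (cardsD1 e) eS.
have sum_mono (h : {set E} -> R) : {homo h : v w / v \subset w >-> v <= w} ->
    {homo (fun w => h w + h (e |: w)) : v w / v \subset w >-> v <= w}.
  by move=> h_mono v w vw; rewrite lerD ?h_mono ?setUS.
rewrite !sum_subsetU1 //.
apply: le_trans (IHn _ leS'n _ _ (sum_mono _ f_mono) (sum_mono _ g_mono)) _.
rewrite cardsU1 eS' exprSr -mulrA ler_pM2l ?exprn_gt0 ?ltr0n // mulr_sumr.
apply: ler_sum => w _.
have f_le : f w <= f (e |: w) by rewrite f_mono ?subsetUr.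
have g_le : g w <= g (e |: w) by rewrite g_mono ?subsetUr.
(* Expanding this product gives the two-point Chebyshev inequality. *)
have : 0 <= (f (e |: w) - f w) * (g (e |: w) - g w).
  by rewrite mulr_ge0 // subr_ge0.
nra.
Qed.

(** * Clusters as increasing unions of balls *)

Section Spread.
Variables (V : finType) (s : V).

Definition spread (r : rel V) (X : {set V}) : {set V} :=
  s |: [set y | [exists x in X, r x y]].

(** The vertices that [r] joins to [s] by a path of fewer than [k] steps. The
    iteration starts from [set0] to match [fixset]. *)
Definition layer (r : rel V) k : {set V} := iter k (spread r) set0.

Lemma spread_mono r : {homo spread r : X Y / X \subset Y}.
Proof.
move=> X Y sXY; apply: setUS; apply/subsetP => y; rewrite !inE.
case/exists_inP => x xX rxy; apply/exists_inP; exists x => //.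
exact: (subsetP sXY).
Qed.

Lemma layer_mono r : {homo layer r : i j / (i <= j)%N >-> i \subset j}.
Proof. exact: (subset_iter (@spread_mono r)). Qed.

Lemma layerS_sub r k : layer r k \subset layer r k.+1.
Proof. exact: layer_mono. Qed.

(** A path to a new vertex never needs more than [#|V| - 1] steps, so the layers
    are stationary from this index on. *)
Lemma layer_connect r : layer r #|V| = [set u | connect r s u].
Proof.
have fixL : spread r (layer r #|V|) = layer r #|V|.
  exact: (fixsetK (@spread_mono r)).
apply/eqP; rewrite eqEsubset; apply/andP; split.
  elim: #|V| => [|k IHk]; first exact: sub0set.
  rewrite [layer _ _]/= subUset sub1set inE connect0 /=.
  apply/subsetP => y; rewrite !inE => /exists_inP[x xL rxy].
  have := subsetP IHk x xL; rewrite inE => sx.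
  exact: connect_trans sx (connect1 rxy).
apply/subsetP => u; rewrite inE => /connectP[p sp ->].
have: s \in layer r #|V| by rewrite -fixL setU11.
elim: p (s) sp => //= y p IHp x /andP[rxy yp] xL; apply: IHp => //.
by rewrite -fixL !inE; apply/orP; right; apply/exists_inP; exists x.
Qed.

End Spread.

(** * Orientations as percolation configurations *)

Section Percolation.
Variable G : graph.
Implicit Types (o : orientation G) (w : {set edge G}) (s : vertex G).

Definition open_adj w : rel (vertex G) :=
  [rel x y | [exists e, (e \in w) && ((ends e == (x, y)) || (ends e == (y, x)))]].

Definition open_cluster w s : {set vertex G} := [set u | connect (open_adj w) s u].

Lemma open_cluster_mono s : {homo open_cluster^~ s : v w / v \subset w}.
Proof.
move=> v w svw; apply/subsetP => u; rewrite !inE; apply: connect_sub => x y.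
case/existsP => e /andP[ev exy]; apply: connect1.
by apply/existsP; exists e; rewrite (subsetP svw).
Qed.

(** The second endpoint is strictly closer to [s] than the first, a vertex that
    cannot be reached being infinitely far. Saying so through a separating layer
    makes it visible that only the layers of [r] matter, and these are what the
    oriented graph and the percolation graph share. *)
Definition back_closer s (r : rel (vertex G)) (e : edge G) : bool :=
  [exists k : 'I_#|vertex G|,
    ((ends e).2 \in layer s r k) && ((ends e).1 \notin layer s r k)].

Definition open_of s o : {set edge G} :=
  [set e | o e (+) back_closer s (directed_adj o) e].

(** The layers increase, so no layer can separate the endpoints of [e] in the
    opposite way to layer [k]; hence [e] is open exactly when it is directed
    outwards across the boundary of layer [k]. *)
Lemma open_of_boundary s o (k : 'I_#|vertex G|) x y e :
    x \in layer s (directed_adj o) k -> y \notin layer s (directed_adj o) k ->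
  (edge_tail o e == x) && (edge_head o e == y)
  = (e \in open_of s o) && ((ends e == (x, y)) || (ends e == (y, x))).
Proof.
set L := layer s (directed_adj o) => xL yL.
have xNy : x != y by apply: contraNneq yL => <-.
have outward : ends e = (x, y) -> back_closer s (directed_adj o) e = false.
  move=> exy; apply/negbTE/existsPn => j; rewrite exy /= -/L.
  apply/negP => /andP[yj xj]; have [jk|/ltnW kj] := leqP j k.
    by move/negP: yL; apply; apply: (subsetP (layer_mono _ _ jk)).
  by move/negP: xj; apply; apply: (subsetP (layer_mono _ _ kj)).
have inward : ends e = (y, x) -> back_closer s (directed_adj o) e.
  by move=> eyx; apply/existsP; exists k; rewrite eyx /= xL yL.
rewrite inE /edge_tail /edge_head.
case Ee: (ends e) outward inward => [p q] /= outward inward; rewrite !xpair_eqE.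
have [[px qy]|Nxy] := altP (@andP (p == x) (q == y)).
  rewrite outward; last by rewrite (eqP px) (eqP qy).
  by case: (o e) => /=; rewrite ?px ?qy // (eqP qy) eq_sym (negbTE xNy).
have [[py qx]|Nyx] := altP (@andP (p == y) (q == x)).
  rewrite inward; last by rewrite (eqP py) (eqP qx).
  by case: (o e) => /=; rewrite ?py ?qx // (eqP py) eq_sym (negbTE xNy).
rewrite andbF; case: (o e); first exact: negbTE.
by rewrite andbC; apply: negbTE.
Qed.

(** A vertex outside layer [k] enters the next layer through an edge crossing the
    boundary of layer [k], where both relations agree. *)
Lemma layer_open_of s o k : (k <= #|vertex G|)%N ->
  layer s (open_adj (open_of s o)) k = layer s (directed_adj o) k.
Proof.
elim: k => // k IHk ltk; have {}IHk := IHk (ltnW ltk).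
apply/setP => y; have [yL|yL] := boolP (y \in layer s (directed_adj o) k).
  by rewrite !(subsetP (layerS_sub _ _ _)) ?IHk.
rewrite [layer _ _ k.+1]/= [in RHS]/layer /= -/(layer _ _ k) -/(layer _ _ k).
rewrite IHk !inE; congr (_ || _); apply: eq_existsb => x.
have [xL|//] := boolP (x \in layer s (directed_adj o) k).
apply: eq_existsb => e.
by rewrite (@open_of_boundary s o (Ordinal ltk)).
Qed.

Lemma open_cluster_open_of s o : open_cluster (open_of s o) s = out_cluster o s.
Proof. by rewrite /open_cluster -layer_connect layer_open_of // layer_connect. Qed.

(** The set of open edges determines the layers, hence which edges are read
    backwards. *)
Lemma open_of_inj s : injective (open_of s).
Proof.
move=> o1 o2 eq_open; apply/ffunP => e.
have eq_back : back_closer s (directed_adj o1) e = back_closer s (directed_adj o2) e.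
  apply: eq_existsb => k.
  by rewrite -!(layer_open_of _ _ (ltnW (ltn_ord k))) eq_open.
have: (e \in open_of s o1) = (e \in open_of s o2) by rewrite eq_open.
by rewrite !inE eq_back => /addIb.
Qed.

Lemma open_of_bij s : bijective (open_of s).
Proof.
apply: inj_card_bij (@open_of_inj s) _.
by rewrite card_ffun card_bool -cardsT -powersetT card_powerset cardsT.
Qed.

(** The out-cluster and the percolation cluster at density 1/2 have the same
    law: [open_of s] carries the uniform measure on orientations to the
    uniform measure on edge sets. *)
Lemma PO_out_cluster (R : realFieldType) s (P : pred {set vertex G}) :
  PO R [set o : orientation G | P (out_cluster o s)]
  = 2^-1 ^+ #|edge G| * \sum_(w : {set edge G}) (P (open_cluster w s))%:R.
Proof.
rewrite (reindex (open_of s)) /=; last exact/onW_bij/open_of_bij.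
rewrite /PO mulr_sumr big_mkcond /=; apply: eq_bigr => o _.
rewrite inE open_cluster_open_of prodr_const.
by case: (P _); rewrite ?mulr1 ?mulr0.
Qed.

End Percolation.

Theorem corollary3p4 (R : realFieldType) (G : graph) (a b s : vertex G) :
  PO R [set o : orientation G | a \in out_cluster o s]
    * PO R [set o : orientation G | b \in out_cluster o s]
  <= PO R [set o : orientation G | (a \in out_cluster o s)
                                    && (b \in out_cluster o s)].
Proof.
rewrite (PO_out_cluster R s (fun C => a \in C)).
rewrite (PO_out_cluster R s (fun C => b \in C)).
rewrite (PO_out_cluster R s (fun C => (a \in C) && (b \in C))).
have mem_mono c :
    {homo (fun w => (c \in open_cluster w s)%:R : R) : v w / v \subset w >-> v <= w}.
  move=> v w /(open_cluster_mono s)/subsetP/(_ c).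
  by case: (c \in _) => [/(_ isT) ->|_]; rewrite ?ler0n.
have sub_setT (h : {set edge G} -> R) :
    \sum_(w : {set edge G} | w \subset [set: edge G]) h w = \sum_w h w.
  by apply: eq_bigl => w; rewrite subsetT.
have := harris_subset [set: edge G] (mem_mono a) (mem_mono b).
rewrite !sub_setT => harris.
rewrite mulrACA -mulrA ler_pM2l ?exprn_gt0 ?invr_gt0 ?ltr0n //.
rewrite exprVn ler_pdivrMl ?exprn_gt0 ?ltr0n // -cardsT.
apply: le_trans harris _; rewrite ler_pM2l ?exprn_gt0 ?ltr0n //; apply: ler_sum => w _.
by rewrite -mulnb natrM.
Qed.
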